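(* Let $\mathbf{H}\in\mathbb{R}^{m\times n}$ have full column rank (rows indexed by meters $1,\dots,m$), and let $\mathcal{S}_1,\mathcal{S}_2$ be a partition of a critical set $\mathcal{S}_1\cup\mathcal{S}_2$ of meters. Let $\bar{\mathbf{H}}$ be $\mathbf{H}$ with the rows indexed by $\mathcal{S}_1\cup\mathcal{S}_2$ deleted (so $\bar{\mathbf{H}}$ has rank $n-1$), and let $\Delta\mathbf{x}$ be a unit vector spanning $\mathcal{N}(\bar{\mathbf{H}})$. Let $\mathbf{H}_1$ (resp. $\mathbf{H}_2$) be the $m\times n$ matrix obtained from $\mathbf{H}$ by replacing the rows indexed by $\mathcal{S}_2$ (resp. $\mathcal{S}_1$) with zero rows. Suppose that when the noiseless iterative state estimation is run on the input vector $\mathbf{H}_1\Delta\mathbf{x}$, there is a unique $\mathbf{y}\in\mathbb{R}^n$ such that the final state estimate equals $\mathbf{y}$ for every possible way of breaking ties in bad data identification. Then for every true state $\mathbf{x}\in\mathbb{R}^n$ and every $\eta\in\mathbb{R}$: (1) If the (noisy) iterative state estimation is run on $\bar{\mathbf{z}}=\mathbf{H}\mathbf{x}+\mathbf{e}+\eta\,\mathbf{H}_1\Delta\mathbf{x}$, then $$\lim_{\sigma^2\to 0}\Pr\big(\bar{\mathbf{z}}^{(N)}=\mathbf{H}^{(N)}(\mathbf{x}+\eta\,\mathbf{y})+\mathbf{e}^{(N)}\big)=1.$$ (2) If the (noisy) iterative state estimation is run on $\bar{\mathbf{z}}=\mathbf{H}\mathbf{x}+\mathbf{e}+\eta\,\mathbf{H}_2\Delta\mathbf{x}$,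 then $$\lim_{\sigma^2\to 0}\Pr\big(\bar{\mathbf{z}}^{(N)}=\mathbf{H}^{(N)}(\mathbf{x}+\eta(\Delta\mathbf{x}-\mathbf{y}))+\mathbf{e}^{(N)}\big)=1.$$ Here $N$ is the (random) total number of iterations, and $\bar{\mathbf{z}}^{(N)},\mathbf{H}^{(N)},\mathbf{e}^{(N)}$ are obtained from $\bar{\mathbf{z}},\mathbf{H},\mathbf{e}$ by deleting the rows of all meters removed during the first $N-1$ iterations.
   Context: Measurement model (DC model): $\mathbf{z}=\mathbf{H}\mathbf{x}+\mathbf{e}$ with $\mathbf{H}\in\mathbb{R}^{m\times n}$ of full column rank (''the network is observable''), $\mathbf{e}\sim\mathcal{N}(\mathbf{0},\boldsymbol{\Sigma})$, $\boldsymbol{\Sigma}=\sigma^2\bar{\boldsymbol{\Sigma}}$ with $\bar{\boldsymbol{\Sigma}}$ diagonal with positive entries summing to $1$, and $\sigma^2>0$ a scaling factor. Removing a set of meters means deleting the corresponding rows; a set of meters is observable-preserving if the remaining matrix has full column rank. A set $\mathcal{S}_0$ of meters is a critical set if removing all meters of $\mathcal{S}_0$ makes the remaining matrix rank deficient while removing any strict subset of $\mathcal{S}_0$ does not. Iterative state estimation on an input vector $\mathbf{z}$: set $\mathbf{z}^{(1)}=\mathbf{z}$, $\mathbf{H}^{(1)}=\mathbf{H}$, $\boldsymbol{\Sigma}^{(1)}=\boldsymbol{\Sigma}$. At iteration $k$: compute $\hat{\mathbf{x}}^{(k)}=((\mathbf{H}^{(k)})^T(\boldsymbol{\Sigma}^{(k)})^{-1}\mathbf{H}^{(k)})^{-1}(\mathbf{H}^{(k)})^T(\boldsymbol{\Sigma}^{(k)})^{-1}\mathbf{z}^{(k)}$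 and residue $\mathbf{r}^{(k)}=\mathbf{z}^{(k)}-\mathbf{H}^{(k)}\hat{\mathbf{x}}^{(k)}=\mathbf{W}^{(k)}\mathbf{z}^{(k)}$, where $\mathbf{W}^{(k)}=\mathbf{I}-\mathbf{H}^{(k)}((\mathbf{H}^{(k)})^T(\boldsymbol{\Sigma}^{(k)})^{-1}\mathbf{H}^{(k)})^{-1}(\mathbf{H}^{(k)})^T(\boldsymbol{\Sigma}^{(k)})^{-1}$. Bad data detection: if $(\mathbf{r}^{(k)})^T(\boldsymbol{\Sigma}^{(k)})^{-1}\mathbf{r}^{(k)}\le\tau^{(k)}$ the data are declared good, the algorithm stops with $N=k$ and outputs $\hat{\mathbf{x}}^{(k)}$; here $\tau^{(k)}>0$ is a fixed threshold not depending on $\sigma^2$. Otherwise bad data identification: form the normalized residue $\tilde{\mathbf{r}}^{(k)}=\boldsymbol{\Omega}^{(k)}\mathbf{r}^{(k)}$ with $\boldsymbol{\Omega}^{(k)}$ diagonal, $\boldsymbol{\Omega}^{(k)}_{ii}=0$ if the single meter $\{i\}$ is a critical set for $\mathbf{H}^{(k)}$, and $\boldsymbol{\Omega}^{(k)}_{ii}=1/\sqrt{(\mathbf{W}^{(k)}\boldsymbol{\Sigma}^{(k)})_{ii}}$ otherwise; remove the meter with the largest $|\tilde r^{(k)}_i|$ (ties broken arbitrarily), i.e. delete its row from $\mathbf{z}^{(k)}$, $\mathbf{H}^{(k)}$ and its row and column from $\boldsymbol{\Sigma}^{(k)}$, to get $\mathbf{z}^{(k+1)},\mathbf{H}^{(k+1)},\boldsymbol{\Sigma}^{(k+1)}$,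 and continue. The noiseless iterative state estimation is the same procedure with $\boldsymbol{\Sigma}$ replaced by $\bar{\boldsymbol{\Sigma}}$ and with detection declaring data good if and only if $(\mathbf{r}^{(k)})^T(\bar{\boldsymbol{\Sigma}}^{(k)})^{-1}\mathbf{r}^{(k)}=0$; its final state estimate is $\hat{\mathbf{x}}^{(N)}$. *)

(* Defs.v *)
From HB Require Import structures.
From mathcomp Require Import all_boot all_order all_algebra.
From mathcomp Require Import all_classical all_reals all_analysis.
Set Implicit Arguments. Unset Strict Implicit. Unset Printing Implicit Defensive.
Import Order.TTheory GRing.Theory Num.Theory.
Local Open Scope ring_scope.

Section SE.
Variables (R : realType) (m n : nat) (H : 'M[R]_(m, n)).

(* Keep only the rows indexed by S (the other rows are replaced by 0).
   Used to encode "deleting rows" for rank / null space purposes. *)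
Definition rmask (S : {set 'I_m}) (A : 'M[R]_(m, n)) : 'M[R]_(m, n) :=
  \matrix_(i, j) (if i \in S then A i j else 0).

(* H^(k) = rows of H in the remaining meter set S; observability = full column rank *)
Definition observable (S : {set 'I_m}) : bool := \rank (rmask S H) == n.

Definition critical_set (S S0 : {set 'I_m}) : Prop :=
  S0 \subset S /\ ~~ observable (S :\: S0) /\
  (forall T : {set 'I_m}, T \proper S0 -> observable (S :\: T)).

(* Sig i = Sigma_ii (diagonal covariance).  With remaining meters S:
   Dinv = Sigma^(k)^-1 padded with zeros, G = H^T Sigma^-1 H (restricted). *)
Definition Dinv (Sig : 'I_m -> R) (S : {set 'I_m}) : 'M[R]_m :=
  diag_mx (\row_i (if i \in S then (Sig i)^-1 else 0)).

Definition gain (Sig : 'I_m -> R) (S : {set 'I_m}) : 'M[R]_n :=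
  H^T *m Dinv Sig S *m H.

Definition xhat (Sig : 'I_m -> R) (S : {set 'I_m}) (z : 'cV[R]_m) : 'cV[R]_n :=
  invmx (gain Sig S) *m H^T *m Dinv Sig S *m z.

(* W^(k) (its entries with indices in S are those of W^(k)) *)
Definition Wmat (Sig : 'I_m -> R) (S : {set 'I_m}) : 'M[R]_m :=
  1%:M - H *m invmx (gain Sig S) *m H^T *m Dinv Sig S.

Definition resid (Sig : 'I_m -> R) (S : {set 'I_m}) (z : 'cV[R]_m) : 'cV[R]_m :=
  Wmat Sig S *m z.

Definition chi2 (Sig : 'I_m -> R) (S : {set 'I_m}) (z : 'cV[R]_m) : R :=
  \sum_(i in S) (resid Sig S z i 0) ^+ 2 / Sig i.

Definition nresid (Sig : 'I_m -> R) (S : {set 'I_m}) (z : 'cV[R]_m) (i : 'I_m) : R :=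
  (if `[< critical_set S [set i] >] then 0
   else (Num.sqrt ((Wmat Sig S *m diag_mx (\row_j Sig j)) i i))^-1)
  * resid Sig S z i 0.

(* All runs of the iterative state estimation (all tie-breakings).
   ise_run k S N F : starting at iteration k with remaining meters S,
   the procedure can stop at iteration N with remaining meter set F. *)
Inductive ise_run (Sig : 'I_m -> R) (good : nat -> {set 'I_m} -> Prop)
    (z : 'cV[R]_m) : nat -> {set 'I_m} -> nat -> {set 'I_m} -> Prop :=
| ise_stop k S : good k S -> ise_run Sig good z k S k S
| ise_step k S i N F : ~ good k S -> i \in S ->
    (forall j, j \in S -> `|nresid Sig S z j| <= `|nresid Sig S z i|) ->
    ise_run Sig good z k.+1 (S :\ i) N F -> ise_run Sig good z k S N F.

Definition good_noisy (tau : nat -> R) (Sig : 'I_m -> R) (z : 'cV[R]_m)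
  (k : nat) (S : {set 'I_m}) : Prop := chi2 Sig S z <= tau k.

Definition good_noiseless (Sig : 'I_m -> R) (z : 'cV[R]_m)
  (k : nat) (S : {set 'I_m}) : Prop := chi2 Sig S z = 0.

Definition noisy_run (tau : nat -> R) (Sig : 'I_m -> R) (z : 'cV[R]_m) N F :=
  ise_run Sig (good_noisy tau Sig z) z 1 [set: 'I_m] N F.

Definition noiseless_run (Sigbar : 'I_m -> R) (z : 'cV[R]_m) N F :=
  ise_run Sigbar (good_noiseless Sigbar z) z 1 [set: 'I_m] N F.

End SE.

Local Open Scope classical_set_scope.
Definition mutually_independent {d} {T : measurableType d} {R : realType}
  (P : probability T R) (I : finType) (X : I -> T -> R) : Prop :=
  forall (J : {set I}) (B : I -> set R), (forall i, measurable (B i)) ->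
    P (\bigcap_(i in [set` J]) (X i @^-1` B i)) =
    (\prod_(i in J) P (X i @^-1` B i))%E.

(* Main.v *)
Require Import Defs.
From HB Require Import structures.
From mathcomp Require Import all_boot all_order all_algebra.
From mathcomp Require Import all_classical all_reals all_analysis.
From mathcomp Require Import lra measurable_realfun.
Import Order.TTheory GRing.Theory Num.Theory.
Import numFieldNormedType.Exports.
Local Open Scope ring_scope.
Local Open Scope classical_set_scope.

(* Write a = H1 dx.  Scaling the covariance by s only rescales the chi-square
   statistic by 1/s and the normalized residues by 1/sqrt s, and every residue
   annihilates H x.  Hence, as s -> 0 with the standardized noise bounded by K,
   the noisy run eventually imitates a noiseless run on a: a nonzero noiseless
   residue is detected, and strict inequalities between noiseless normalized
   residues persist, so the removed meter is a noiseless maximizer.  When the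
   noiseless residue vanishes on S, that run ends with estimate y, so a and H y
   agree on S, and therefore on whatever subset of S the noisy run goes on to
   select.  As the noise is bounded by K with probability tending to 1 when
   K -> oo, this gives (1).  Since H1 dx + H2 dx = H dx, the input of (2) is that
   of (1) with x + eta dx and - eta in place of x and eta. *)

Set Implicit Arguments.
Unset Strict Implicit.
Unset Printing Implicit Defensive.

(** * Weighted least squares on a subset of meters: residues, critical meters, scaling of the
    covariance *)

Section WeightedLeastSquares.
Variables (R : realType) (m n : nat) (H : 'M[R]_(m, n)).
Implicit Types (S : {set 'I_m}) (z u : 'cV[R]_m) (v : 'cV[R]_n).

Lemma rmask_mulE S v i :
  (rmask S H *m v) i 0 = if i \in S then (H *m v) i 0 else 0.
Proof.
rewrite [LHS]mxE [X in if _ then X else _]mxE; case: ifP => iS.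
  by apply: eq_bigr => k _; rewrite mxE iS.
by rewrite big1// => k _; rewrite mxE iS mul0r.
Qed.

Lemma observableP S :
  observable H S <->
  (forall v, (forall i, i \in S -> (H *m v) i 0 = 0) -> v = 0).
Proof.
have maskE v : (rmask S H *m v = 0) <-> (forall i, i \in S -> (H *m v) i 0 = 0).
  split=> [Hv i iS|Hv].
    by have := rmask_mulE S v i; rewrite iS Hv mxE.
  by apply/matrixP => i j; rewrite ord1 rmask_mulE [RHS]mxE; case: ifP => // /Hv.
(* [kermx] is a left kernel, so full column rank is read as triviality of the left kernel of the
   transpose. *)
rewrite /observable -mxrank_tr -/(row_free _) -kermx_eq0.
split=> [/rowV0P k0 v /maskE Hv|Hv].
  apply: trmx_inj; rewrite trmx0; apply: k0.
  by apply/sub_kermxP; rewrite -trmx_mul Hv trmx0.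
apply/rowV0P => v /sub_kermxP kv; apply: trmx_inj; rewrite trmx0; apply: Hv.
by apply/maskE; rewrite -[v]trmxK -[LHS]trmxK trmx_mul !trmxK kv trmx0.
Qed.

Variable Sig : 'I_m -> R.
Hypothesis Sig_gt0 : forall i, 0 < Sig i.

Lemma DinvE S z i : (Dinv Sig S *m z) i 0 = if i \in S then z i 0 / Sig i else 0.
Proof.
rewrite /Dinv mul_diag_mx !mxE; case: ifP => _; last by rewrite mul0r.
by rewrite mulrC.
Qed.

Lemma dot_Dinv S z u :
  (u^T *m (Dinv Sig S *m z)) 0 0 = \sum_(i in S) u i 0 * z i 0 / Sig i.
Proof.
rewrite mxE [RHS]big_mkcond /=; apply: eq_bigr => i _.
by rewrite DinvE mxE; case: ifP => _; rewrite ?mulr0 ?mulrA.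
Qed.

Lemma sum_sqr_eq0 S z :
  \sum_(i in S) z i 0 * z i 0 / Sig i = 0 -> forall i, i \in S -> z i 0 = 0.
Proof.
move=> /eqP; rewrite psumr_eq0 => [/allP z0 i iS|i _]; last first.
  by rewrite divr_ge0 -?expr2 ?sqr_ge0 ?(ltW (Sig_gt0 _)).
have := z0 i (mem_index_enum i); rewrite iS /= !mulf_eq0 invr_eq0 orbb.
by rewrite (gt_eqF (Sig_gt0 i)) orbF => /eqP.
Qed.

(** A kernel vector [v] annihilates the quadratic form of the gain matrix, which is the weighted sum
    over [S] of the squared entries of [H v]. These entries all vanish, and observability forces
    [v = 0]. *)
Lemma gain_unit S : observable H S -> gain H Sig S \in unitmx.
Proof.
move=> /observableP obs; rewrite -row_free_unit -kermx_eq0.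
apply/rowV0P => v /sub_kermxP kv.
apply: trmx_inj; rewrite trmx0; apply: obs; apply: sum_sqr_eq0.
rewrite -dot_Dinv trmx_mul trmxK.
have -> : v *m H^T *m (Dinv Sig S *m (H *m v^T)) = v *m gain H Sig S *m v^T.
  by rewrite /gain !mulmxA.
by rewrite kv mul0mx mxE.
Qed.

Lemma residE S z : resid H Sig S z = z - H *m xhat H Sig S z.
Proof. by rewrite /resid /Wmat mulmxBl mul1mx /xhat !mulmxA. Qed.

Lemma resid_mulH S v : observable H S -> resid H Sig S (H *m v) = 0.
Proof.
move=> /gain_unit gu.
rewrite residE /xhat -!mulmxA (mulmxA H^T) (mulmxA (H^T *m _)).
by rewrite -/(gain H Sig S) mulKmx// subrr.
Qed.

Lemma normal_equations S z v : observable H S ->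
  \sum_(i in S) (H *m v) i 0 * resid H Sig S z i 0 / Sig i = 0.
Proof.
move=> /gain_unit gu; rewrite -dot_Dinv residE trmx_mul -mulmxA.
have -> : H^T *m (Dinv Sig S *m (z - H *m xhat H Sig S z)) = 0.
  rewrite !mulmxBr !mulmxA -/(gain H Sig S) mulmxV// mul1mx.
  by rewrite subrr.
by rewrite mulmx0 mxE.
Qed.

Lemma chi2_eq0 S z :
  chi2 H Sig S z = 0 <-> (forall i, i \in S -> resid H Sig S z i 0 = 0).
Proof.
split=> [c0|r0]; last first.
  by rewrite /chi2 big1// => i iS; rewrite r0// expr0n mul0r.
apply: sum_sqr_eq0; rewrite -[RHS]c0; by apply: eq_bigr => i _; rewrite expr2.
Qed.

Lemma critical1P S i : observable H S -> i \in S ->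
  critical_set H S [set i]%SET <-> ~~ observable H (S :\ i).
Proof.
move=> obs iS; split=> [[_ []]//|nobs]; split; first by rewrite finset.sub1set.
split=> // T; rewrite properE subset1 => /andP[/orP[]/eqP-> ].
  by rewrite fintype.subxx.
by rewrite finset.setD0.
Qed.

(** Some [v] has [H v] nonzero at [i] and zero on the rest of [S]. The residue is orthogonal to
    [H v] in the weighted inner product, which isolates its entry at [i]. *)
Lemma resid_critical S z i : observable H S -> i \in S ->
  critical_set H S [set i]%SET -> resid H Sig S z i 0 = 0.
Proof.
move=> obs iS /critical1P => /(_ obs iS) nobs.
have [v [v0 Hv0]] : exists v, v <> 0 /\
    forall j, j \in (S :\ i)%SET -> (H *m v) j 0 = 0.
  apply: contrapT => h; move/negP: nobs; apply; apply/observableP => v Hv.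
  by apply: contrapT => v0; apply: h; exists v.
have Hvi : (H *m v) i 0 != 0.
  apply/eqP => Hvi; apply: v0; move/observableP: obs; apply => j jS.
  have [->//|ji] := eqVneq j i; by apply: Hv0; rewrite !inE ji.
have := normal_equations z v obs; rewrite (big_setD1 i)//= big1 => [|j jSi].
  rewrite addr0 => /eqP; rewrite !mulf_eq0 invr_eq0 (negbTE Hvi).
  by rewrite (gt_eqF (Sig_gt0 i)) orbF => /eqP.
by rewrite Hv0// !mul0r.
Qed.

(* The residue [r] of the basis vector [e_i] satisfies
   [r^T Sigma^-1 r = e_i^T Sigma^-1 r = W_ii / Sigma_ii]. *)
Lemma Wmat_diag_gt0 S i : i \in S -> observable H (S :\ i) ->
  0 < Wmat H Sig S i i.
Proof.
move=> iS /observableP obs'.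
have obs : observable H S.
  apply/observableP => v Hv; apply: obs' => j; rewrite !inE => /andP[_].
  exact: Hv.
pose ei : 'cV[R]_m := delta_mx i 0.
have eiE j : ei j 0 = (j == i)%:R by rewrite mxE andbT.
pose r := resid H Sig S ei.
have ri : r i 0 = Wmat H Sig S i i.
  rewrite /r /resid mxE (bigD1 i)//= big1 ?addr0 => [|j ji].
    by rewrite eiE eqxx mulr1.
  by rewrite eiE (negbTE ji) mulr0.
have rE : \sum_(j in S) r j 0 * r j 0 / Sig j = Wmat H Sig S i i / Sig i.
  have -> : \sum_(j in S) r j 0 * r j 0 / Sig j =
      \sum_(j in S) ei j 0 * r j 0 / Sig j.
    (* Since [ei - r = H xhat], the difference of the two sums is the left side of
       [normal_equations]. *)
    apply/eqP; rewrite eq_sym -subr_eq0 -sumrB.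
    rewrite -[X in _ == X](normal_equations ei (xhat H Sig S ei) obs).
    apply/eqP/eq_bigr => j _; rewrite -/r -!mulrBl; congr (_ * _ / _).
    by rewrite {1}/r residE !mxE subKr.
  rewrite (big_setD1 i)//= big1 ?addr0 => [|j].
    by rewrite eiE eqxx mul1r ri.
  by rewrite !inE eiE => /andP[/negbTE-> _]; rewrite !mul0r.
have W0 : 0 <= Wmat H Sig S i i / Sig i.
  by rewrite -rE sumr_ge0// => j _; rewrite divr_ge0 -?expr2 ?sqr_ge0 ?(ltW (Sig_gt0 _)).
suff : Wmat H Sig S i i != 0.
  by rewrite lt0r => ->; move: W0; rewrite pmulr_lge0// invr_gt0.
apply/eqP => Wii; move: rE; rewrite Wii mul0r => /sum_sqr_eq0 r0.
have Hx j : j \in S -> (H *m xhat H Sig S ei) j 0 = ei j 0.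
  by move=> jS; have /eqP := r0 j jS; rewrite /r residE mxE [X in _ + X]mxE subr_eq0 => /eqP <-.
have x0 : xhat H Sig S ei = 0.
  by apply: obs' => j; rewrite !inE => /andP[/negbTE ji jS]; rewrite Hx// eiE ji.
by have /eqP := Hx i iS; rewrite x0 mulmx0 eiE mxE eqxx eq_sym oner_eq0.
Qed.

(** Normalization loses no information: a critical meter has zero residue anyway, and for any other
    meter the factor is nonzero by [Wmat_diag_gt0]. *)
Lemma nresid_eq0 S z i : observable H S -> i \in S ->
  nresid H Sig S z i = 0 -> resid H Sig S z i 0 = 0.
Proof.
move=> obs iS; rewrite /nresid.
case: asboolP => [/(resid_critical z obs iS)//|nc].
move/eqP; rewrite mulf_eq0 => /orP[|/eqP//].
rewrite invr_eq0 sqrtr_eq0 leNgt mul_mx_diag mxE [X in _ * X]mxE mulr_gt0//.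
apply: Wmat_diag_gt0 => //; apply: contrapT => /negP nobs.
by apply: nc; apply/critical1P.
Qed.

(** Critical meters get normalized residue 0 by definition. This is what carries observability from
    one iteration to the next. *)
Lemma nresid_neq0_observable S z i : observable H S -> i \in S ->
  nresid H Sig S z i != 0 -> observable H (S :\ i).
Proof.
move=> obs iS; apply: contraR => /critical1P => /(_ obs iS) c.
by rewrite /nresid asboolT// mul0r.
Qed.

Lemma residD S z u : resid H Sig S (z + u) = resid H Sig S z + resid H Sig S u.
Proof. by rewrite /resid mulmxDr. Qed.

Lemma residZ S c z : resid H Sig S (c *: z) = c *: resid H Sig S z.
Proof. by rewrite /resid -scalemxAr. Qed.

Variable s : R.
Hypothesis s_gt0 : 0 < s.

(** The factor [s^-1] of the weights cancels against the factor [s] of the inverse gain. *)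
Lemma Wmat_scale S : observable H S -> Wmat H (fun i => s * Sig i) S = Wmat H Sig S.
Proof.
move=> obs.
have DinvZ : Dinv (fun i => s * Sig i) S = s^-1 *: Dinv Sig S.
  apply/matrixP => i j; rewrite !mxE mulrnAr; congr (_ *+ _).
  by case: ifP; rewrite ?mulr0// invfM.
have gainZ : gain H (fun i => s * Sig i) S = s^-1 *: gain H Sig S.
  by rewrite /gain DinvZ -scalemxAr -scalemxAl.
have sV : s^-1 \is a GRing.unit by rewrite unitfE invr_eq0 gt_eqF.
rewrite /Wmat gainZ DinvZ invmxZ; last first.
  by rewrite unitmxZ ?gain_unit.
rewrite invrK -!(scalemxAl, scalemxAr) scalerA mulVf ?scale1r//.
by rewrite gt_eqF.
Qed.

Lemma nresid_scale S z i : observable H S ->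
  nresid H (fun i => s * Sig i) S z i = (Num.sqrt s)^-1 * nresid H Sig S z i.
Proof.
move=> obs; rewrite /nresid /resid Wmat_scale//.
case: asboolP => _; first by rewrite !mul0r mulr0.
have dE (D : 'I_m -> R) :
    (Wmat H Sig S *m diag_mx (\row_j D j)) i i = Wmat H Sig S i i * D i.
  by rewrite mul_mx_diag mxE [X in _ * X]mxE.
by rewrite !dE (mulrCA _ s) sqrtrM ?ltW// invfM mulrA.
Qed.

Lemma chi2_scale S z : observable H S ->
  chi2 H (fun i => s * Sig i) S z = s^-1 * chi2 H Sig S z.
Proof.
move=> obs; rewrite /chi2 /resid Wmat_scale// mulr_sumr.
by apply: eq_bigr => i _; rewrite invfM mulrCA.
Qed.

End WeightedLeastSquares.

(** * Runs of the iterative estimation, and noisy runs tracking noiseless ones *)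

Lemma ise_run_forall (R : realType) (m n : nat) (H : 'M[R]_(m, n))
    (Sig : 'I_m -> R) good z k (S : {set 'I_m}) (C : {set 'I_m} -> Prop) :
  (forall N F, ise_run H Sig good z k S N F -> C F) <->
  (good k S -> C S) /\
  (forall i, i \in S ->
    ~ good k S ->
    (forall j, j \in S -> `|nresid H Sig S z j| <= `|nresid H Sig S z i|) ->
    forall N F, ise_run H Sig good z k.+1 (S :\ i)%SET N F -> C F).
Proof.
split=> [run|[stop step] N F r].
  split=> [g|i iS ng imax N F r]; first exact: run (ise_stop _ _ _ g).
  exact: run (ise_step ng iS imax r).
case: r stop step => [k' S' g stop _|k' S' i N' F' ng iS imax r _ step].
  exact: stop.
exact: step iS ng imax _ _ r.
Qed.

Section Simulation.
Variables (R : realType) (m n : nat) (H : 'M[R]_(m, n)) (Sig : 'I_m -> R).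
Variables (tau : nat -> R) (a : 'cV[R]_m) (y : 'cV[R]_n).
Hypothesis Sig_gt0 : forall i, 0 < Sig i.

(* Starting from all meters at iteration 1, the meter set S is reached at
   iteration [m.+1 - #|S|]. *)
Definition separates (s : R) (z : 'cV[R]_m) (S : {set 'I_m}) : Prop :=
  (forall i, i \in S -> resid H Sig S a i 0 != 0 ->
     s * tau (m.+1 - #|S|)%N < resid H Sig S z i 0 ^+ 2 / Sig i) /\
  (forall i j, `|nresid H Sig S a i| < `|nresid H Sig S a j| ->
     `|nresid H Sig S z i| < `|nresid H Sig S z j|).

(* Once the noiseless residue vanishes, the conclusion holds for every further
   subset of meters, so the noisy run needs to follow the noiseless one only
   up to that point. *)
Lemma noisy_run_follows (s : R) (z : 'cV[R]_m) k (S : {set 'I_m}) N (F : {set 'I_m}) :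
  0 < s ->
  (forall S', observable H S' -> separates s z S') ->
  (k + #|S| = m.+1)%N ->
  (observable H S /\ (forall N F,
    ise_run H Sig (good_noiseless H Sig a) a k S N F -> xhat H Sig F a = y)) \/
  (forall i, i \in S -> a i 0 = (H *m y) i 0) ->
  ise_run H (fun i => s * Sig i) (good_noisy H tau (fun i => s * Sig i) z)
    z k S N F ->
  forall i, i \in F -> a i 0 = (H *m y) i 0.
Proof.
move=> s0 sep + + run; elim: {k S N F} run => [k S good|k S i N F ngood iS imax _ IH].
  move=> kS [[obs noiseless]|//].
  have kE : (m.+1 - #|S| = k)%N by rewrite -kS addnK.
  have chi0 : chi2 H Sig S a = 0.
    apply/(chi2_eq0 _ Sig_gt0) => i iS; apply/eqP; apply: contraT => ri.
    (* A nonzero noiseless residue at [i] makes a single term of the noisy sum exceed [s * tau k],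
       whereas stopping bounds the whole sum of nonnegative terms by that value. *)
    have [/(_ i iS ri) + _] := sep S obs; rewrite kE.
    move: good; rewrite /good_noisy chi2_scale// ler_pdivrMl// => good.
    move=> /(le_lt_trans good); rewrite ltNge => /negP; case.
    rewrite /chi2 (big_setD1 i)//= lerDl sumr_ge0// => j _.
    by rewrite divr_ge0 ?sqr_ge0// ltW.
  move=> i iS; have /chi2_eq0 := chi0 => /(_ Sig_gt0 i iS).
  rewrite residE (noiseless k S (ise_stop _ _ _ chi0)).
  by rewrite mxE [X in _ + X]mxE => /eqP; rewrite subr_eq0 => /eqP.
have kS' : (k + #|S| = m.+1 -> k.+1 + #|(S :\ i)%SET| = m.+1)%N.
  by rewrite (cardsD1 i S) iS add1n addnS.
move=> kS ind; apply: IH; first exact: kS'.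
have sub : (forall j, j \in S -> a j 0 = (H *m y) j 0) ->
    forall j, j \in (S :\ i)%SET -> a j 0 = (H *m y) j 0.
  by move=> aS j; rewrite !inE => /andP[_ /aS].
case: ind => [[obs noiseless]|]; last by right; apply: sub.
(* Here a noiseless run would stop with estimate [y] although the noisy one goes on: from now on
   only the agreement of [a] with [H y] is carried along. *)
have [chi0|chi0] := pselect (chi2 H Sig S a = 0).
  right; apply: sub => j jS; have /chi2_eq0 := chi0 => /(_ Sig_gt0 j jS).
  rewrite residE (noiseless k S (ise_stop _ _ _ chi0)).
  by rewrite mxE [X in _ + X]mxE => /eqP; rewrite subr_eq0 => /eqP.
left.
have amax j : j \in S -> `|nresid H Sig S a j| <= `|nresid H Sig S a i|.
  move=> jS; rewrite leNgt; apply/negP => /(sep S obs).2.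
  have := imax j jS; rewrite !nresid_scale// !normrM ler_pM2l.
    by rewrite leNgt => /negP.
  by rewrite normr_gt0 invr_eq0 gt_eqF// sqrtr_gt0.
split; last first.
  move=> N' F' r; apply: (noiseless N' F').
  exact: ise_step chi0 iS amax r.
(* Some residue on [S] is nonzero, hence so is its normalized value, hence so is the maximal one,
   attained at [i]. *)
apply: (nresid_neq0_observable (Sig := Sig) (z := a) obs iS).
have [j [jS rj]] : exists j, j \in S /\ resid H Sig S a j 0 <> 0.
  apply: contrapT => h; apply: chi0; apply/chi2_eq0 => // j jS.
  by apply: contrapT => rj; apply: h; exists j.
rewrite -normr_gt0; apply: lt_le_trans (amax j jS).
by rewrite normr_gt0; apply/eqP => /(nresid_eq0 Sig_gt0 obs jS).
Qed.

End Simulation.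

(** * Bounded noise separates signals once [s] is small *)

Lemma nbhs0_right_mul_lt (R : realType) (c d : R) : 0 < d ->
  \forall s \near 0^'+, s * c < d.
Proof.
(* [c] may be zero or negative; a positive upper bound can be divided by. *)
move=> d0; have c1 : 0 < `|c| + 1 by rewrite ltr_wpDl.
near=> s; have s0 : 0 < s by near: s; exact: nbhs_right_gt.
apply: (@le_lt_trans _ _ (s * (`|c| + 1))).
  by rewrite ler_wpM2l ?(ltW s0)//; apply: le_trans (ler_norm c) _; rewrite lerDl.
rewrite -ltr_pdivlMr//; near: s; apply: nbhs_right_lt.
exact: divr_gt0.
Unshelve. all: by end_near. Qed.

Lemma nbhs0_right_sqrt_mul_lt (R : realType) (c d : R) : 0 < d ->
  \forall s \near 0^'+, Num.sqrt s * c < d.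
Proof.
move=> d0; have [c0|c0] := leP c 0.
  by apply: nearW => s; apply: le_lt_trans d0; rewrite mulr_ge0_le0// sqrtr_ge0.
near=> s.
rewrite -ltr_pdivlMr// -[X in _ < X]gtr0_norm ?divr_gt0// -sqrtr_sqr.
rewrite ltr_sqrt; last by rewrite exprn_gt0// divr_gt0.
by near: s; apply: nbhs_right_lt; rewrite exprn_gt0// divr_gt0.
Unshelve. all: by end_near. Qed.

Section SmallNoise.
Variables (R : realType) (m n : nat) (H : 'M[R]_(m, n)) (Sig : 'I_m -> R).
Hypothesis Sig_gt0 : forall i, 0 < Sig i.

Definition Wbound (S : {set 'I_m}) i : R := \sum_j `|Wmat H Sig S i j|.

Lemma resid_bound S (u : 'cV[R]_m) K i : (forall j, `|u j 0| <= K) ->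
  `|resid H Sig S u i 0| <= Wbound S i * K.
Proof.
move=> uK; rewrite /resid mxE /Wbound mulr_suml.
apply: le_trans (ler_norm_sum _ _ _) _; apply: ler_sum => j _.
by rewrite normrM ler_wpM2l.
Qed.

Lemma nresid_coef (S : {set 'I_m}) i :
  exists c, forall z, nresid H Sig S z i = c * resid H Sig S z i 0.
Proof. by eexists => z; rewrite /nresid. Qed.

(** Each required inequality compares a fixed positive gap with a term of order [s] or [sqrt s].
    There are finitely many meter sets and meters, so one threshold on [s] serves them all,
    uniformly in the noise bounded by [K]. *)
Lemma near_separates (tau : nat -> R) (a : 'cV[R]_m) (x : 'cV[R]_n) eta K :
  eta != 0 ->
  \forall s \near 0^'+, forall u : 'cV[R]_m, (forall j, `|u j 0| <= K) ->
    forall S, observable H S ->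
      separates H Sig tau a s (H *m x + Num.sqrt s *: u + eta *: a) S.
Proof.
move=> eta0.
have zE S s u i : observable H S ->
    resid H Sig S (H *m x + Num.sqrt s *: u + eta *: a) i 0 =
    Num.sqrt s * resid H Sig S u i 0 + eta * resid H Sig S a i 0.
  by move=> obs; rewrite !residD !residZ resid_mulH// add0r !mxE.
(* Half of the signal [|eta * r|] absorbs the noise; the other half, squared, must still exceed the
   detection threshold. *)
have detect : \forall s \near 0^'+, forall (S : {set 'I_m}) i,
    resid H Sig S a i 0 != 0 ->
    s * (tau (m.+1 - #|S|)%N * Sig i) < (`|eta * resid H Sig S a i 0| / 2) ^+ 2 /\
    Num.sqrt s * (Wbound S i * K) < `|eta * resid H Sig S a i 0| / 2.
  apply: filter_forall => S; apply: filter_forall => i.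
  have [->|r0] := eqVneq (resid H Sig S a i 0) 0; first exact: nearW.
  have r2 : 0 < `|eta * resid H Sig S a i 0| / 2.
    by rewrite divr_gt0// normr_gt0 mulf_neq0.
  near=> s => _; split; near: s; first by apply: nbhs0_right_mul_lt; rewrite exprn_gt0.
  exact: nbhs0_right_sqrt_mul_lt.
have identify : \forall s \near 0^'+, forall (S : {set 'I_m}) i j,
    `|nresid H Sig S a i| < `|nresid H Sig S a j| ->
    forall u : 'cV[R]_m, (forall k, `|u k 0| <= K) -> observable H S ->
    `|nresid H Sig S (H *m x + Num.sqrt s *: u + eta *: a) i| <
    `|nresid H Sig S (H *m x + Num.sqrt s *: u + eta *: a) j|.
  apply: filter_forall => S; apply: filter_forall => i; apply: filter_forall => j.
  have [ij|ij] := ltP `|nresid H Sig S a i| `|nresid H Sig S a j|; last exact: nearW.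
  have [ci ciE] := nresid_coef S i; have [cj cjE] := nresid_coef S j.
  near=> s => _ u uK obs; rewrite ciE cjE !zE// !mulrDr ![_ * (eta * _)]mulrCA.
  rewrite -ciE -cjE.
  have bnd c k : `|c * (Num.sqrt s * resid H Sig S u k 0)| <=
      Num.sqrt s * (`|c| * (Wbound S k * K)).
    rewrite mulrCA !normrM (ger0_norm (sqrtr_ge0 s)).
    by rewrite !ler_wpM2l ?sqrtr_ge0 ?resid_bound.
  (* The noise at [i] and [j] together is smaller than the gap between the two noiseless values
     scaled by [|eta|], so the order is kept. *)
  have key : Num.sqrt s * (`|ci| * (Wbound S i * K) + `|cj| * (Wbound S j * K)) <
      `|eta| * (`|nresid H Sig S a j| - `|nresid H Sig S a i|).
    near: s; apply: nbhs0_right_sqrt_mul_lt.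
    by rewrite mulr_gt0 ?normr_gt0// subr_gt0.
  have := lerB_normD (eta * nresid H Sig S a j) (cj * (Num.sqrt s * resid H Sig S u j 0)).
  have := ler_normD (ci * (Num.sqrt s * resid H Sig S u i 0)) (eta * nresid H Sig S a i).
  rewrite [eta * _ + _]addrC !(normrM eta).
  have := bnd ci i; have := bnd cj j; move: key; rewrite mulrDr mulrBr.
  lra.
apply: filterS2 detect identify => s det ide u uK S obs.
split=> [i iS /det [h1 h2]|i j /ide]; last exact.
rewrite ltr_pdivlMr// -mulrA; apply: lt_le_trans h1 _.
rewrite -[leRHS]real_normK ?num_real// lerXn2r ?nnegrE ?divr_ge0//.
rewrite zE// addrC; apply: le_trans (lerB_normD _ _).
have : `|Num.sqrt s * resid H Sig S u i 0| <= Num.sqrt s * (Wbound S i * K).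
  by rewrite normrM (ger0_norm (sqrtr_ge0 s)) ler_wpM2l ?sqrtr_ge0 ?resid_bound.
lra.
Unshelve. all: by end_near. Qed.

End SmallNoise.

(** * Measurability of events quantified over all runs *)

Lemma measurable_Prop {d} {T : measurableType d} (Q : Prop) :
  measurable [set _ : T | Q].
Proof.
have [q|nq] := pselect Q.
  by rewrite (_ : [set _ | _] = setT)//; apply/seteqP; split.
by rewrite (_ : [set _ | _] = set0)//; apply/seteqP; split.
Qed.

Section Measurability.
Context {d} {T : measurableType d} (R : realType) (m n : nat).
Variables (H : 'M[R]_(m, n)) (Sig : 'I_m -> R) (z : T -> 'cV[R]_m).
Hypothesis mz : forall i, measurable_fun setT (fun w => z w i 0).

Lemma measurable_resid S i :
  measurable_fun setT (fun w => resid H Sig S (z w) i 0).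
Proof.
under eq_fun do rewrite /resid mxE.
by apply: measurable_sum => j; apply: measurable_funM.
Qed.

Lemma measurable_nresid S i :
  measurable_fun setT (fun w => nresid H Sig S (z w) i).
Proof. by apply: measurable_funM => //; exact: measurable_resid. Qed.

Lemma measurable_chi2 S : measurable_fun setT (fun w => chi2 H Sig S (z w)).
Proof.
rewrite (_ : (fun w => _) = fun w => \sum_i
    if i \in S then resid H Sig S (z w) i 0 ^+ 2 / Sig i else 0); last first.
  by apply/funext => w; rewrite /chi2 big_mkcond.
apply: measurable_sum => i; case: (i \in S) => //.
by apply: measurable_funM => //; apply: measurable_funX; exact: measurable_resid.
Qed.

(** Induction on the number of remaining meters: [ise_run_forall] unfolds one iteration and writes
    the event as a finite Boolean combination of the stopping event, comparisons of normalized
    residues, and the same event for each [S :\ i]. *)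
Lemma measurable_ise_run (good : T -> nat -> {set 'I_m} -> Prop)
    (C : {set 'I_m} -> Prop) k S :
  (forall k S, measurable [set w | good w k S]) ->
  measurable [set w | forall N F,
    ise_run H Sig (good w) (z w) k S N F -> C F].
Proof.
move=> mgood; have [p] := ubnP #|S|; elim: p => // p IH in k S *.
rewrite ltnS => Sp.
rewrite (_ : [set w | _] =
    (~` [set w | good w k S] `|` [set _ | C S]) `&`
    \bigcap_(i in [set` S])
      ([set w | good w k S] `|`
       ~` (\bigcap_(j in [set` S])
            [set w | `|nresid H Sig S (z w) j| <= `|nresid H Sig S (z w) i|]) `|`
       [set w | forall N F,
         ise_run H Sig (good w) (z w) k.+1 (S :\ i)%SET N F -> C F])).
  apply: measurableI.
    by apply: measurableU; [apply: measurableC|exact: measurable_Prop].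
  apply: fin_bigcap_measurable => // i /= iS; apply: measurableU; last first.
    by apply: IH; apply: leq_trans Sp; rewrite [ltnRHS](cardsD1 i) iS.
  apply: measurableU => //; apply: measurableC.
  apply: fin_bigcap_measurable => // j _.
  rewrite -[X in measurable X]setTI; apply: measurable_fun_le => //;
    by apply: measurableT_comp => //; exact: measurable_nresid.
apply/seteqP; split => w /=.
  move=> /ise_run_forall [stop step]; split.
    by have [/stop|] := pselect (good w k S); [right|left].
  move=> i /= iS; have [|ng] := pselect (good w k S); first by left; left.
  have [imax|nmax] := pselect (forall j, j \in S ->
      `|nresid H Sig S (z w) j| <= `|nresid H Sig S (z w) i|).
    by right; exact: step iS ng imax.
  by left; right => imax; apply: nmax => j jS; exact: imax.
move=> [stop step]; apply/ise_run_forall; split=> [g|i iS ng imax].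
  by case: stop.
by case: (step i iS) => // -[//|]; case => j jS; exact: imax.
Qed.

End Measurability.

(** * Convergence of probabilities to 1 *)

Section Probability.
Context {d} {T : measurableType d} (R : realType) (P : probability T R).

(** The events [B k] bounding all [X i] by [k] increase to the whole space, so one of them has
    probability at least [1 - e]. For that [k], the last hypothesis puts [B k] inside [A s] for all
    small [s > 0]. *)
Lemma cvg_probability1 (I : finType) (X : I -> T -> R) (A : R -> set T) :
  (forall i, measurable_fun setT (X i)) ->
  (forall s, measurable (A s)) ->
  (forall K : R, \forall s \near 0^'+, forall w,
     (forall i, `|X i w| <= K) -> A s w) ->
  P (A s) @[s --> 0^'+] --> 1%E.
Proof.
move=> mX mA bA.
pose B (k : nat) := \bigcap_(i in [set: I]) [set w | `|X i w| <= k%:R].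
have mB k : measurable (B k).
  apply: fin_bigcap_measurable => // i _.
  rewrite -[X in measurable X]setTI; apply: measurable_fun_le => //.
  exact: measurableT_comp.
have BT : \bigcup_k B k = setT.
  apply/seteqP; split => // w _.
  exists (\max_(i : I) (Num.trunc `|X i w|).+1)%N => // i _ /=.
  apply: le_trans (ltW (truncnS_gt _)) _; rewrite ler_nat.
  exact: leq_bigmax.
have cB : P (B k) @[k --> \oo] --> 1%E.
  rewrite -(probability_setT P) -BT; apply: nondecreasing_cvg_mu => //.
    by rewrite BT.
  move=> k l kl; apply/subsetPset => w Bw i iI; apply: le_trans (Bw i iI) _.
  by rewrite ler_nat.
have finP (D : set T) : measurable D -> P D = (fine (P D))%:E.
  by move=> mD; rewrite fineK// fin_num_measure.
apply/fine_cvgP; split; first by apply: nearW => s; exact: fin_num_measure.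
apply/cvgrPdist_le => e e0.
have /fine_cvgP [_ /cvgrPdist_le /(_ e e0) [k _ /(_ k (leqnn k)) /= Bk]] := cB.
have := bA k%:R; apply: filterS => s sA.
have BA : (P (B k) <= P (A s))%E.
  by rewrite le_measure ?inE// => w Bw; apply: sA => i; exact: Bw.
have A1 : (P (A s) <= 1)%E := probability_le1 P (mA s).
rewrite (finP (A s))// (finP (B k))// lee_fin in BA.
rewrite (finP (A s))// lee_fin in A1.
move: Bk; rewrite ger0_norm ?subr_ge0 ?(le_trans BA)// ger0_norm ?subr_ge0//.
lra.
Qed.

End Probability.

(** * The limit for a general input, then both claims *)

Section NoisyLimit.
Context {d} {T : measurableType d} (R : realType) (m n : nat).
Variables (H : 'M[R]_(m, n)) (Sig : 'I_m -> R) (tau : nat -> R).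
Variables (P : probability T R) (eps : 'I_m -> T -> R).
Hypothesis Sig_gt0 : forall i, 0 < Sig i.
Hypothesis rankH : \rank H = n.
Hypothesis meps : forall i, measurable_fun setT (eps i).

Let e s w := \col_i (Num.sqrt s * eps i w) : 'cV[R]_m.

Lemma noisy_limit (a : 'cV[R]_m) (y x : 'cV[R]_n) (eta : R) :
  (forall N F, noiseless_run H Sig a N F -> xhat H Sig F a = y) ->
  P [set w | let zb := H *m x + e s w + eta *: a in
      forall N F, noisy_run H tau (fun i => s * Sig i) zb N F ->
      forall i, i \in F -> zb i 0 = (H *m (x + eta *: y) + e s w) i 0]
    @[s --> 0^'+] --> 1%E.
Proof.
move=> noiseless.
(* The terms [H x] and [e] cancel from the conclusion, leaving a condition on [F] alone. Keeping the
   factor [eta] makes it trivial when [eta = 0], the case [near_separates] excludes. *)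
pose C (F : {set 'I_m}) := forall i, i \in F -> eta * a i 0 = eta * (H *m y) i 0.
rewrite (_ : (fun s => _) = fun s => P [set w | forall N F,
    noisy_run H tau (fun i => s * Sig i) (H *m x + e s w + eta *: a) N F -> C F]);
  last first.
  apply/funext => s; congr (P _); apply/seteqP; split => w /= h N F r i iF;
    have := h N F r i iF; rewrite mulmxDr -scalemxAr !mxE; lra.
apply: (@cvg_probability1 _ _ _ _ _ eps) => //.
  move=> s.
  have mz i : measurable_fun setT (fun w => (H *m x + e s w + eta *: a) i 0).
    rewrite (_ : (fun w => _) = fun w => (H *m x) i 0 + Num.sqrt s * eps i w + eta * a i 0).
      by do 2 apply: measurable_funD => //; exact: measurable_funM.
    by apply/funext => w; rewrite mxE [X in X + _]mxE [X in _ + X + _]mxE [X in _ + X]mxE.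
  apply: (measurable_ise_run H (fun i => s * Sig i) mz) => k S.
  rewrite -[X in measurable X]setTI; apply: measurable_fun_le => //.
  exact: measurable_chi2.
move=> K; have [eta0|eta0] := eqVneq eta 0.
  by apply: nearW => s w _ N F _ i _; rewrite eta0 !mul0r.
have := near_separates H Sig_gt0 tau a x K eta0.
apply: filterS2 (nbhs_right_gt 0) => s s0 sep w epsK N F run i iF; congr (_ * _).
pose u : 'cV[R]_m := \col_i eps i w.
have eE : e s w = Num.sqrt s *: u by apply/matrixP => k l; rewrite !mxE.
move: run; rewrite /noisy_run eE => run.
apply: (noisy_run_follows Sig_gt0 (y := y) s0 _ _ _ run) iF.
- by move=> S'; apply: sep => j; rewrite mxE.
- by rewrite cardsT card_ord add1n.
- left; split=> //; rewrite /observable (_ : rmask _ _ = H) ?rankH//.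
  by apply/matrixP => k l; rewrite mxE inE.
Qed.

End NoisyLimit.
Theorem theorem2 (R : realType) (m n : nat) (H : 'M[R]_(m, n))
  (Sigbar : 'I_m -> R) (tau : nat -> R)
  (S1 S2 : {set 'I_m}) (dx : 'cV[R]_n)
  (d : measure_display) (T : measurableType d) (P : probability T R)
  (eps : 'I_m -> T -> R) :
  \rank H = n ->
  (forall i, 0 < Sigbar i) -> \sum_i Sigbar i = 1 ->
  (forall k, 0 < tau k) ->
  S1 :&: S2 = finset.set0 ->
  critical_set H [set: 'I_m]%SET (S1 :|: S2) ->
  \sum_j dx j 0 ^+ 2 = 1 ->
  (forall v : 'cV[R]_n, rmask (~: (S1 :|: S2)) H *m v = 0 <->
     exists c : R, v = c *: dx) ->
  (* noise model: e = sqrt(sigma^2) * eps with eps ~ N(0, Sigbar), independent *)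
  (forall i, measurable_fun setT (eps i)) ->
  (forall i A, measurable A ->
     P (eps i @^-1` A) = normal_prob 0 (Num.sqrt (Sigbar i)) A) ->
  mutually_independent P eps ->
  let H1 := rmask (~: S2) H in
  let H2 := rmask (~: S1) H in
  (exists! y : 'cV[R]_n, forall N F,
      noiseless_run H Sigbar (H1 *m dx) N F -> xhat H Sigbar F (H1 *m dx) = y) ->
  forall y : 'cV[R]_n,
  (forall N F,
      noiseless_run H Sigbar (H1 *m dx) N F -> xhat H Sigbar F (H1 *m dx) = y) ->
  forall (x : 'cV[R]_n) (eta : R),
  let Sig s := fun i => s * Sigbar i in
  let e s w := \col_i (Num.sqrt s * eps i w) : 'cV[R]_m in
  ((fun s : R => P [set w | let zb := H *m x + e s w + eta *: (H1 *m dx) in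
       forall N F, noisy_run H tau (Sig s) zb N F ->
         forall i, i \in F ->
           zb i 0 = (H *m (x + eta *: y) + e s w) i 0])
     @ 0^'+ --> 1%E)
  /\
  ((fun s : R => P [set w | let zb := H *m x + e s w + eta *: (H2 *m dx) in
       forall N F, noisy_run H tau (Sig s) zb N F ->
         forall i, i \in F ->
           zb i 0 = (H *m (x + eta *: (dx - y)) + e s w) i 0])
     @ 0^'+ --> 1%E).
Proof.
move=> rankH Sig_gt0 _ _ S12 _ _ dxP meps _ _ H1 H2 _ y noiseless x eta Sig e.
split; first exact: noisy_limit.
(* On [S1] only [H1] keeps the row, on [S2] only [H2] does. Elsewhere both keep it, but there [H dx]
   vanishes because [dx] lies in the null space of the remaining rows. *)
have H12 : H2 *m dx = H *m dx - H1 *m dx.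
  have dx0 : rmask (~: (S1 :|: S2)) H *m dx = 0.
    by apply/dxP; exists 1; rewrite scale1r.
  apply/matrixP => i j; rewrite ord1 [RHS]mxE [X in _ + X]mxE !rmask_mulE !inE.
  have := rmask_mulE H (~: (S1 :|: S2)) dx i; rewrite dx0 mxE !inE.
  have : (i \in S1 :&: S2) = false by rewrite S12 inE.
  rewrite inE; case: (i \in S1); case: (i \in S2) => //= _; last move=> <-.
  - by rewrite subrr.
  - by rewrite subr0.
  - by rewrite subr0.
have zE s w : H *m x + e s w + eta *: (H2 *m dx) =
    H *m (x + eta *: dx) + e s w + (- eta) *: (H1 *m dx).
  rewrite H12 scalerBr scaleNr mulmxDr -scalemxAr !addrA; congr (_ - _).
  by rewrite addrAC.
have yE : x + eta *: (dx - y) = x + eta *: dx + (- eta) *: y.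
  by rewrite scalerBr scaleNr addrA.
have := @noisy_limit _ _ R m n H Sigbar tau P eps Sig_gt0 rankH meps
  (H1 *m dx) y (x + eta *: dx) (- eta) noiseless.
rewrite [X in X @ _ --> _](_ : _ = fun s => P [set w |
    let zb := H *m x + e s w + eta *: (H2 *m dx) in
    forall N F, noisy_run H tau (Sig s) zb N F ->
      forall i, i \in F ->
        zb i 0 = (H *m (x + eta *: (dx - y)) + e s w) i 0])//.
apply/funext => s; congr (P _); apply/funext => w.
by rewrite /= zE yE.
Qed.
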